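(* Let $S=(X,P)$ be a stochastic approximation space, let $T:X\to P^*(X)$ be a set-valued mapping, and let $U$ be a random variable on $X$ with finitely many values $u_1,\dots,u_n$. For any real constants $a$ and $b$, there is a real number $c$ with $0\le c\le 1$ such that $$\underline{E}(aU+b)=a\,\underline{E}(U)+bc .$$
   Context: $P^*(X)$ denotes the set of all non-empty subsets of a non-empty set $X$. A stochastic approximation space is a pair $S=(X,P)$ where $X$ is a non-empty set and $P$ is a probability measure on $X$. For a set-valued mapping $T:X\to P^*(X)$ and $A\subseteq X$, the lower inverse of $A$ is $T^+(A)=\{x\in X : T(x)\subseteq A\}$. It is understood that $T^+(A)$ is an event whenever $A$ is. The lower probability of an event $A$ is $\underline{P}(A)=P(T^+(A))$. A random variable $U$ is a real-valued random variable on $X$ taking finitely many distinct values $u_1,\dots,u_n$, and $\underline{P}(U=u_k)=\underline{P}(\{x\in X: U(x)=u_k\})$. The lower expectation of $U$ is $\underline{E}(U)=\sum_{k=1}^n u_k\,\underline{P}(U=u_k)$, and for a function $g:\mathbb{R}\to\mathbb{R}$ the lower expectation of $g(U)$ is understood as $\underline{E}(g(U))=\sum_{k=1}^n g(u_k)\,\underline{P}(U=u_k)$. *)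

(* Defs.v *)
From HB Require Import structures.
From mathcomp Require Import all_boot all_order all_algebra.
From mathcomp Require Import all_classical all_reals all_analysis.
Set Implicit Arguments.
Unset Strict Implicit.
Unset Printing Implicit Defensive.
Import Order.TTheory GRing.Theory Num.Theory.
Local Open Scope classical_set_scope.
Local Open Scope ring_scope.

Definition lower_inverse (X : Type) (T : X -> set X) (A : set X) : set X :=
  [set x | T x `<=` A].

(* A probability takes values in [\bar R]; [fine] reads off the real value,
   which loses nothing when [lower_inverse T A] is measurable. *)
Definition lower_probability (d : measure_display) (X : measurableType d)
    (R : realType) (P : probability X R) (T : X -> set X) (A : set X) : R :=
  fine (P (lower_inverse T A)).

(* Both sums range over the distinct values of [U]. They are meant for [U] with
   a finite range: [\sum_(u \in D)] is 0 by convention on infinite supports. *)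
Definition lower_expectation (d : measure_display) (X : measurableType d)
    (R : realType) (P : probability X R) (T : X -> set X)
    (U : {RV P >-> R}) : R :=
  \sum_(u \in range U) u * lower_probability P T [set x | U x = u].

(* The lower expectation of [g(U)] weights [g u] by the lower probability of
   [U = u]: the values of [U] that [g] identifies are not merged. *)
Definition lower_expectation_of (d : measure_display) (X : measurableType d)
    (R : realType) (P : probability X R) (T : X -> set X)
    (g : R -> R) (U : {RV P >-> R}) : R :=
  \sum_(u \in range U) g u * lower_probability P T [set x | U x = u].

(* Main.v *)
(* The values that [E(g U)] attaches to [U] are weighted by the lower
   probabilities of the events [U = u], so [c] has to be their sum. It is at most
   1: [T x] is nonempty, so it cannot lie in two disjoint sets, hence the lower
   inverses of the events [U = u] are again disjoint. *)
Require Import Defs.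
From HB Require Import structures.
From mathcomp Require Import all_boot all_order all_algebra.
From mathcomp Require Import all_classical all_reals all_analysis.
Import Order.TTheory GRing.Theory Num.Theory.
Local Open Scope classical_set_scope.
Local Open Scope ring_scope.

Lemma trivIset_lower_inverse (X : Type) (T : X -> set X)
    (T_nonempty : forall x : X, T x !=set0) (I : Type) (D : set I)
    (F : I -> set X) :
  trivIset D F -> trivIset D (fun i => lower_inverse T (F i)).
Proof.
move=> tF i j Di Dj [x [/= TFi TFj]].
(* A common point [x] of two lower inverses yields a common point [y] of [F i] and [F j], which
   forces [i = j]. *)
have [y Ty] := T_nonempty x.
by apply: (tF i j Di Dj); exists y; split; [exact: TFi | exact: TFj].
Qed.

Lemma lower_probability_ge0 (d : measure_display) (X : measurableType d)
    (R : realType) (P : probability X R) (T : X -> set X) (A : set X) :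
  0 <= lower_probability P T A.
Proof. exact/fine_ge0/measure_ge0. Qed.

(** By finite additivity the sum is the probability of the union of the lower inverses. *)
Lemma fsum_lower_probability_le1 (d : measure_display) (X : measurableType d)
    (R : realType) (P : probability X R) (T : X -> set X)
    (T_nonempty : forall x : X, T x !=set0)
    (T_event : forall A : set X, measurable A -> measurable (lower_inverse T A))
    (I : choiceType) (D : set I) (F : I -> set X) :
  finite_set D -> (forall i, D i -> measurable (F i)) -> trivIset D F ->
  \sum_(i \in D) lower_probability P T (F i) <= 1.
Proof.
move=> finD mF tF.
have mTF i : D i -> measurable (lower_inverse T (F i)) by move=> /mF/T_event.
(* Additivity of [P] lives in [\bar R]; [fine] is then removed because the lower inverses have
   finite probability. *)
rewrite -lee_fin -fsumEFin//.
rewrite (eq_fsbigr (fun i => P (lower_inverse T (F i)))); last first.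
  by move=> i /set_mem Di; rewrite fineK// fin_num_measure//; exact: mTF.
rewrite -measure_fin_bigcup//; last exact: trivIset_lower_inverse.
exact/probability_le1/fin_bigcup_measurable.
Qed.

Theorem theorem2p14 (d : measure_display) (X : measurableType d)
    (R : realType) (P : probability X R)
    (T : X -> set X) (T_nonempty : forall x : X, T x !=set0)
    (T_event : forall A : set X, measurable A -> measurable (lower_inverse T A))
    (U : {RV P >-> R}) (U_finite : finite_set (range U)) (a b : R) :
  exists c : R, 0 <= c <= 1 /\
    lower_expectation_of T (fun x : R => a * x + b) U
      = a * lower_expectation T U + b * c.
Proof.
exists (\sum_(u \in range U) lower_probability P T [set x | U x = u]).
split.
  rewrite fsumr_ge0 => [|u _]; last exact: lower_probability_ge0.
  apply: fsum_lower_probability_le1 => // [u _|].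
    exact: (measurable_sfunP U (measurable_set1 u)).
  exact: trivIset_preimage1.
(* Both sides sum over [range U], even when [a = 0] makes all the values [a * u + b] coincide, so it
   suffices to compare terms. *)
rewrite /lower_expectation_of /lower_expectation !mulr_fsumr -fsbig_split//=.
by apply: eq_fsbigr => u _; rewrite mulrDl mulrA.
Qed.
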